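(* Let $0<\epsilon<0.01$. For all sufficiently large $N$, if $M$ is an $N\times N$ complex circulant matrix or an $N\times N$ complex Toeplitz matrix, then \[ \textsf{r}^{\mathbb{C}}_M\left(\frac{N}{\exp\left(\epsilon^6(\log N)^{0.35}\right)}\right)\le N^{15\epsilon}. \]
   Context: An $N\times N$ circulant matrix is one whose rows are obtained by cyclically shifting the top row, i.e. $M_{ij}$ depends only on $(j-i)\bmod N$. A Toeplitz matrix is one with $M_{ij}$ depending only on $i-j$. For a matrix $M$ over a field $\mathbb{F}$ and real $r$, $\textsf{r}^{\mathbb{F}}_M(r)$ is the smallest $s$ such that $M=A+B$ over $\mathbb{F}$ with $A$ having at most $s$ nonzero entries in each row and column and $\operatorname{rank}(B)\le r$. *)

(* Defs.v *)
From mathcomp Require Import all_boot all_order all_algebra.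
From mathcomp Require Import complex.
From mathcomp Require Import boolp classical_sets reals.

Set Implicit Arguments.
Unset Strict Implicit.
Unset Printing Implicit Defensive.

Import Order.TTheory GRing.Theory Num.Theory.

Local Open Scope ring_scope.

Section Rigidity.
Variables (R : realType) (F : fieldType) (n : nat).
Implicit Types (M A B : 'M[F]_n) (r : R) (s : nat).

Definition sparse_mx s A : Prop :=
  (forall i, (#|[set j | A i j != 0%R]| <= s)%N) /\
  (forall j, (#|[set i | A i j != 0%R]| <= s)%N).

Definition sparse_low_rank_split M r s : Prop :=
  exists A B, [/\ M = A + B, sparse_mx s A & (\rank B)%:R <= r].

Definition is_rigidity M r s : Prop :=
  sparse_low_rank_split M r s /\
  forall t, sparse_low_rank_split M r t -> (s <= t)%N.

(* For r < 0 no split exists, and the value is the junk value n;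
   for 0 <= r see rigidityP. *)
Definition rigidity M r : nat := xget n [set s | is_rigidity M r s]%classic.

Lemma rigidityP M r : 0 <= r -> is_rigidity M r (rigidity M r).
Proof.
move=> r_ge0; rewrite /rigidity.
case: xgetP => [s -> // | no_min].
have exP : exists s, `[< sparse_low_rank_split M r s >].
  exists n; apply/asboolP; exists M, 0; split; rewrite ?addr0 ?mxrank0 //.
  by split=> k; rewrite (leq_trans (max_card _)) ?card_ord.
case: (ex_minnP exP) => s /asboolP splits min_s.
case: (no_min s); split=> // t /asboolP; exact: min_s.
Qed.

End Rigidity.

Definition circulant (F : fieldType) (n : nat) (M : 'M[F]_n) : Prop :=
  forall i j k l : 'I_n,
    (j%:Z - i%:Z = l%:Z - k%:Z %[mod n%:Z])%Z -> M i j = M k l.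

Definition toeplitz (F : fieldType) (n : nat) (M : 'M[F]_n) : Prop :=
  forall i j k l : 'I_n, i%:Z - j%:Z = k%:Z - l%:Z -> M i j = M k l.

(* Main.v *)
Require Import Defs.
From mathcomp Require Import all_boot all_order all_algebra.
From mathcomp Require Import fingroup perm cyclic separable cyclotomic.
From mathcomp Require Import complex.
From mathcomp Require Import boolp reals sequences exp.
From mathcomp Require Import zify ring lra.

Set Implicit Arguments.
Unset Strict Implicit.
Unset Printing Implicit Defensive.

Import Order.TTheory GRing.Theory Num.Theory.

Local Open Scope ring_scope.

(** A circulant matrix is Toeplitz, so only Toeplitz matrices matter.
    Fix finitely many primes p between 2^j and 4^j, let Q be their product and
    let d be about Q/2. Writing indices in base d, with n digits, turns x - y
    into a vector of digit differences, each of which is determined modulo Q;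
    so an N x N Toeplitz matrix with N <= d^n is a submatrix of a matrix
    T(x - y) over the group (Z/Q)^n = prod_p (Z/p)^n, at the price of a factor
    2^n in the size. Such a matrix is F diag F^-1, where F is the tensor
    product of the matrices F_p of the Fourier transforms of the groups Z/p.

    By LU decomposition and recursive halving, F_p is a product of O(log p)
    matrices, each block diagonal with blocks [I 0; C I]. A tensor product of
    matrices [I 0; C I] has nonzero entries (x, y) only if x is obtained from y
    by moving some coordinates from the top half to the bottom half. By
    Chernoff's bound, all but an exp(- c delta^2 n t) fraction of the indices
    have, up to delta n t, half of their n t coordinates in the bottom half (t
    is the number of primes); once the other rows and columns are removed, x
    and y differ in at most 2 delta n t coordinates, so few entries per row and
    column remain. The sparsity stays below N^(15 eps) for delta = c eps / j.
    As t grows faster than j^2 by Chebyshev's bound, j can be chosen so large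
    in terms of eps that exp(- c delta^2 n t) beats the loss 2^n, and the rank
    is at most N^(1 - c(eps)). *)

(** * Products of layers *)

Section Layers.
Variables (R : realType) (F : fieldType) (mu s : R).

(** Matrices are functions on arbitrary finite types, so that tensor products and direct sums have
    the index types [X * Y] and [X + Y] without any renumbering. *)
Definition kmul (X : finType) (e f : X -> X -> F) : X -> X -> F :=
  fun x y => \sum_z e x z * f z y.

Definition kid (X : finType) : X -> X -> F := fun x y => (x == y)%:R.

Definition ktens (X Y : finType) (e : X -> X -> F) (f : Y -> Y -> F)
  : X * Y -> X * Y -> F := fun p q => e p.1 q.1 * f p.2 q.2.

Definition kdsum (X Y : finType) (e : X -> X -> F) (f : Y -> Y -> F)
    (p q : X + Y) : F :=
  match p, q with
  | inl x, inl x' => e x x'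
  | inr y, inr y' => f y y'
  | _, _ => 0
  end.

(* The two moment bounds make the weight [w] concentrate around 0; the two
   support bounds say that few entries (x, y) have [w x] close to [w y]. All
   four are multiplicative under tensor products. *)
Definition layer (B m : R) (X : finType) (e : X -> X -> F) : Prop :=
  exists w : X -> R,
    [/\ forall x, \sum_(y | e x y != 0) expR (- mu * (w x - w y)) <= B,
        forall y, \sum_(x | e x y != 0) expR (- mu * (w x - w y)) <= B,
        \sum_x expR (s * w x) <= #|X|%:R * m &
        \sum_x expR (- s * w x) <= #|X|%:R * m].

(** The number [K] of factors is exact and all factors share [B] and [m], so that tensor products
    and direct sums can be formed factor by factor. *)
Fixpoint layered (K : nat) (B m : R) (X : finType) (f : X -> X -> F) : Prop :=
  if K is K'.+1 then
    exists e g, [/\ layer B m e, layered K' B m g & f = kmul e g]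
  else f = @kid X.

Lemma kmulA (X : finType) (e f g : X -> X -> F) :
  kmul (kmul e f) g = kmul e (kmul f g).
Proof.
apply/funext => x; apply/funext => y; rewrite /kmul.
under eq_bigr => z _ do rewrite mulr_suml.
rewrite exchange_big; apply: eq_bigr => z _ /=.
by rewrite mulr_sumr; apply: eq_bigr => t _; rewrite mulrA.
Qed.

Lemma kmul1k (X : finType) (f : X -> X -> F) : kmul (@kid X) f = f.
Proof.
apply/funext => x; apply/funext => y; rewrite /kmul /kid (bigD1 x) //= eqxx.
rewrite mul1r big1 ?addr0 // => z; rewrite eq_sym => /negPf ->.
by rewrite mul0r.
Qed.

Lemma kmulk1 (X : finType) (f : X -> X -> F) : kmul f (@kid X) = f.
Proof.
apply/funext => x; apply/funext => y; rewrite /kmul /kid (bigD1 y) //= eqxx.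
by rewrite mulr1 big1 ?addr0 // => z /negPf ->; rewrite mulr0.
Qed.

Lemma ktens_mul (X Y : finType) (e e' : X -> X -> F) (f f' : Y -> Y -> F) :
  kmul (ktens e f) (ktens e' f') = ktens (kmul e e') (kmul f f').
Proof.
apply/funext => p; apply/funext => q; rewrite /kmul /ktens.
rewrite big_distrlr pair_bigA /=; apply: eq_bigr => z _; ring.
Qed.

Lemma ktens_id (X Y : finType) : ktens (@kid X) (@kid Y) = @kid _.
Proof.
apply/funext => -[x y]; apply/funext => -[x' y']; rewrite /ktens /kid /=.
by rewrite -natrM mulnb xpair_eqE.
Qed.

Lemma kdsum_mul (X Y : finType) (e e' : X -> X -> F) (f f' : Y -> Y -> F) :
  kmul (kdsum e f) (kdsum e' f') = kdsum (kmul e e') (kmul f f').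
Proof.
apply/funext => -[x|y]; apply/funext => -[x'|y'];
  rewrite /kmul big_sumType /=.
- by rewrite [X in _ + X]big1 ?addr0 // => i _; rewrite mul0r.
- by rewrite !big1 ?addr0 // => i _; rewrite ?mul0r ?mulr0.
- by rewrite !big1 ?addr0 // => i _; rewrite ?mul0r ?mulr0.
- by rewrite [X in X + _]big1 ?add0r // => i _; rewrite mul0r.
Qed.

Lemma kdsum_id (X Y : finType) : kdsum (@kid X) (@kid Y) = @kid _.
Proof. by apply/funext => -[x|y]; apply/funext => -[x'|y']. Qed.

Section Closure.
Variables (B m : R).

Lemma layered1 (X : finType) (e : X -> X -> F) : layer B m e -> layered 1 B m e.
Proof. by move=> eL; exists e, (@kid X); split=> //; rewrite kmulk1. Qed.

Lemma layered_comp (K1 K2 : nat) (X : finType) (f g : X -> X -> F) :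
  layered K1 B m f -> layered K2 B m g -> layered (K1 + K2) B m (kmul f g).
Proof.
elim: K1 f => [|K1 IH] f /=; first by move=> -> gL; rewrite kmul1k.
move=> [e [h [eL hL ->]]] gL; exists e, (kmul h g); split=> //.
  exact: IH.
exact: kmulA.
Qed.

Lemma layer_tr (X : finType) (e : X -> X -> F) :
  layer B m e -> layer B m (fun x y => e y x).
Proof.
move=> [w [wr wc wp wn]]; exists (fun x => - w x); split.
- move=> x; under eq_bigr => y _ do rewrite opprK addrC; exact: wc.
- move=> x; under eq_bigr => y _ do rewrite opprK addrC; exact: wr.
- by under eq_bigr => x _ do rewrite mulrN -mulNr.
- by under eq_bigr => x _ do rewrite mulrNN.
Qed.

Lemma layered_tr (K : nat) (X : finType) (f : X -> X -> F) :
  layered K B m f -> layered K B m (fun x y => f y x).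
Proof.
elim: K f => [|K IH] f.
  by move=> /= ->; apply/funext => x; apply/funext => y; rewrite /kid eq_sym.
move=> [e [g [eL gL ->]]]; rewrite -addn1.
have -> : (fun x y => kmul e g y x)
        = kmul (fun x y => g y x) (fun x y => e y x).
  apply/funext => x; apply/funext => y; apply: eq_bigr => z _; exact: mulrC.
by apply: layered_comp (IH _ gL) _; apply: layered1; exact: layer_tr.
Qed.

Lemma layer_reindex (X Y : finType) (h : X -> Y) (e : Y -> Y -> F) :
  bijective h -> layer B m e -> layer B m (fun x x' => e (h x) (h x')).
Proof.
move=> hbij [w [wr wc wp wn]]; have hb P : {on P, bijective h} by exact: onW_bij.
exists (w \o h); rewrite (bij_eq_card hbij); split.
- by move=> x; rewrite -(reindex h (P := fun y => e (h x) y != 0)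
    (F := fun y => expR (- mu * (w (h x) - w y)))).
- by move=> x; rewrite -(reindex h (P := fun y => e y (h x) != 0)
    (F := fun y => expR (- mu * (w y - w (h x))))).
- by rewrite (reindex h) in wp.
- by rewrite (reindex h) in wn.
Qed.

Lemma layered_reindex (K : nat) (X Y : finType) (h : X -> Y) (f : Y -> Y -> F) :
  bijective h -> layered K B m f ->
  layered K B m (fun x x' => f (h x) (h x')).
Proof.
move=> hbij; elim: K f => [|K IH] f /=.
  move=> ->; apply/funext => x; apply/funext => y.
  by rewrite /kid (bij_eq hbij).
move=> [e [g [eL gL ->]]].
exists (fun x y => e (h x) (h y)), (fun x y => g (h x) (h y)).
split; [exact: layer_reindex | exact: IH |].
apply/funext => x; apply/funext => y; rewrite /kmul (reindex h) //.
exact: onW_bij.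
Qed.

(** The moment bounds are normalised by the cardinality, so they add up over the two blocks with the
    same [m]; no nonzero entry links the blocks. *)
Lemma layer_dsum (X Y : finType) (e : X -> X -> F) (f : Y -> Y -> F) :
  layer B m e -> layer B m f -> layer B m (kdsum e f).
Proof.
move=> [w [wr wc wp wn]] [v [vr vc vp vn]].
exists (fun p => match p with inl x => w x | inr y => v y end).
rewrite card_sum natrD mulrDl.
split.
- move=> [x|y]; rewrite big_sumType /=.
    by rewrite [X in _ + X]big1 ?addr0 // => i; rewrite eqxx.
  by rewrite [X in X + _]big1 ?add0r // => i; rewrite eqxx.
- move=> [x|y]; rewrite big_sumType /=.
    by rewrite [X in _ + X]big1 ?addr0 // => i; rewrite eqxx.
  by rewrite [X in X + _]big1 ?add0r // => i; rewrite eqxx.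
- by rewrite big_sumType lerD.
- by rewrite big_sumType lerD.
Qed.

Lemma layered_dsum (K : nat) (X Y : finType)
    (e : X -> X -> F) (f : Y -> Y -> F) :
  layered K B m e -> layered K B m f -> layered K B m (kdsum e f).
Proof.
elim: K e f => [|K IH] e f /=; first by move=> -> ->; exact: kdsum_id.
move=> [e1 [e2 [e1L e2L ->]]] [f1 [f2 [f1L f2L ->]]].
exists (kdsum e1 f1), (kdsum e2 f2).
by split; [exact: layer_dsum | exact: IH | rewrite kdsum_mul].
Qed.

End Closure.

(** Adding the two weights turns all four exponential sums into products. *)
Lemma layer_tens (B m B' m' : R) (X Y : finType)
    (e : X -> X -> F) (f : Y -> Y -> F) :
  layer B m e -> layer B' m' f -> layer (B * B') (m * m') (ktens e f).
Proof.
move=> [w [wr wc wp wn]] [v [vr vc vp vn]].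
have prod_le (I J : finType) (P : pred I) (Q : pred J) (a : I -> R)
    (b : J -> R) A C : \sum_(i | P i) expR (a i) <= A ->
    \sum_(j | Q j) expR (b j) <= C ->
    \sum_(p : I * J | P p.1 && Q p.2) expR (a p.1 + b p.2) <= A * C.
  move=> leA leC; under eq_bigr => p _ do rewrite expRD.
  rewrite -(pair_big P Q (fun i j => expR (a i) * expR (b j))) -big_distrlr /=.
  by apply: ler_pM => //; apply: sumr_ge0 => i _; exact: expR_ge0.
exists (fun p => w p.1 + v p.2); rewrite card_prod natrM.
rewrite (_ : _ * _ * _ = #|X|%:R * m * (#|Y|%:R * m')); last by ring.
split.
- move=> [x y]; move: (prod_le _ _ _ _ _ _ _ _ (wr x) (vr y)); apply: le_trans.
  rewrite le_eqVlt; apply/orP; left; apply/eqP.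
  apply: eq_big => [[x' y'] | [x' y'] _] /=.
    by rewrite /ktens mulf_eq0 negb_or.
  by congr expR; ring.
- move=> [x y]; move: (prod_le _ _ _ _ _ _ _ _ (wc x) (vc y)); apply: le_trans.
  rewrite le_eqVlt; apply/orP; left; apply/eqP.
  apply: eq_big => [[x' y'] | [x' y'] _] /=.
    by rewrite /ktens mulf_eq0 negb_or.
  by congr expR; ring.
- move: (prod_le _ _ _ _ _ _ _ _ wp vp) => /=.
  by under eq_bigr => p _ do rewrite -mulrDr.
- move: (prod_le _ _ _ _ _ _ _ _ wn vn) => /=.
  by under eq_bigr => p _ do rewrite -mulrDr.
Qed.

Lemma layered_tens (B m B' m' : R) (K : nat) (X Y : finType)
    (e : X -> X -> F) (f : Y -> Y -> F) :
  layered K B m e -> layered K B' m' f ->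
  layered K (B * B') (m * m') (ktens e f).
Proof.
elim: K e f => [|K IH] e f /=; first by move=> -> ->; exact: ktens_id.
move=> [e1 [e2 [e1L e2L ->]]] [f1 [f2 [f1L f2L ->]]].
exists (ktens e1 f1), (ktens e2 f2).
by split; [exact: layer_tens | exact: IH | rewrite ktens_mul].
Qed.

(** Each row and each column has at most one nonzero entry, so the weight 0 suffices. This covers
    diagonal and permutation matrices. *)
Lemma layer_monomial (B m : R) (X : finType) (h : X -> X) (a : X -> F) :
  1 <= B -> 1 <= m -> injective h ->
  layer B m (fun x y => a x * (h x == y)%:R).
Proof.
move=> B1 m1 hinj; exists (fun=> 0).
have le1 (P : pred X) x0 : (forall x, P x -> x = x0) ->
    \sum_(y | P y) expR (- mu * (0 - 0)) <= B.
  move=> Px0; rewrite (le_trans _ B1) //.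
  rewrite subrr mulr0 expR0 sumr_const -[leRHS]/(1%:R) ler_nat.
  rewrite -(card1 x0); apply/subset_leq_card/subsetP => x; rewrite !inE.
  by move=> /Px0 ->.
have cardm (c : R) : \sum_(x : X) expR (c * 0) <= #|X|%:R * m.
  by rewrite mulr0 expR0 sumr_const ler_peMr.
split=> //.
- move=> x; apply: (le1 _ (h x)) => y.
  by case: (h x =P y) => [->|_] //; rewrite mulr0 eqxx.
- move=> y; case: (pickP (fun x => h x == y)) => [x0 /eqP hx0|no].
    apply: (le1 _ x0) => x.
    case: (h x =P y) => [hx _|]; last by rewrite mulr0 eqxx.
    by apply: hinj; rewrite hx.
  rewrite big_pred0 ?(le_trans ler01) // => x.
  by rewrite no mulr0 eqxx.
Qed.

End Layers.

(** * Invertible matrices as products of few layers *)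

(** Since [(1 - y) * expR y <= 1], it is enough that [1 - y] times the right-hand side is
    [1 + y ^+ 2 * (1 - 2 * y)], which is at least 1. *)
Lemma expR_le_quad (R : realType) (y : R) :
  y <= 1 / 2 -> expR y <= 1 + y + 2 * y ^+ 2.
Proof.
move=> y_le; have y1 : 0 < 1 - y by lra.
have : 1 - y <= expR (- y) by exact: expR_ge1Dx.
rewrite expRN => le_inv; have ey := expR_gt0 y.
have le1 : (1 - y) * expR y <= 1.
  by rewrite -ler_pdivlMr // div1r.
rewrite -(ler_pM2l y1) (le_trans le1) //.
have : 0 <= y ^+ 2 * (1 - 2 * y) by rewrite mulr_ge0 ?sqr_ge0 //; lra.
have -> : (1 - y) * (1 + y + 2 * y ^+ 2) = 1 + y ^+ 2 * (1 - 2 * y) by ring.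
by rewrite lerDl.
Qed.

Definition kshear (F : fieldType) (X Y : finType) (C : Y -> X -> F)
    (p q : X + Y) : F :=
  match p, q with
  | inl x, inl x' => (x == x')%:R
  | inl _, inr _ => 0
  | inr y, inl x => C y x
  | inr y, inr y' => (y == y')%:R
  end.

Section Triangular.
Variables (R : realType) (F : fieldType) (mu s B m : R).
Hypotheses (s_small : `|s| <= 1 / 2) (m_ge : 1 + 2 * s ^+ 2 <= m).

Lemma layer_shear (X Y : finType) (C : Y -> X -> F) :
  1 + (#|X| + #|Y|)%:R * expR (- mu) <= B -> layer mu s B m (kshear C).
Proof.
set n := (#|X| + #|Y|)%N => B_ge.
pose a : R := #|X|%:R / n%:R; pose b : R := #|Y|%:R / n%:R.
have emu := expR_gt0 (- mu).
have n_ge0 : 0 <= n%:R :> R by exact: ler0n.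
have cardX_le : #|X|%:R <= n%:R :> R by rewrite ler_nat leq_addr.
have cardY_le : #|Y|%:R <= n%:R :> R by rewrite ler_nat leq_addl.
have a01 : 0 <= a <= 1.
  rewrite divr_ge0 ?ler0n //=; have [n0|n0] := eqVneq n 0%N.
    by rewrite /a n0 invr0 mulr0 ler01.
  by rewrite ler_pdivrMr ?mul1r // ltr0n lt0n.
have b01 : 0 <= b <= 1.
  rewrite divr_ge0 ?ler0n //=; have [n0|n0] := eqVneq n 0%N.
    by rewrite /b n0 invr0 mulr0 ler01.
  by rewrite ler_pdivrMr ?mul1r // ltr0n lt0n.
have ab1 : (0 < n)%N -> a + b = 1.
  by move=> n0; rewrite -mulrDl -natrD divff // pnatr_eq0 -lt0n.
have one_le (Z : finType) (z : Z) (P : pred Z) (c d : R) :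
    (forall z', P z' -> z' = z) -> \sum_(z' | P z') expR (d * (c - c)) <= 1.
  move=> Pz; rewrite subrr mulr0 expR0 sumr_const -[leRHS]/(1%:R) ler_nat.
  rewrite -(card1 z); apply/subset_leq_card/subsetP => x; rewrite !inE.
  by move=> /Pz ->.
(* An entry of the block [C] makes the weight drop from [a] to [- b], that is by 1, and so
   contributes only [expR (- mu)]. *)
have off_le (Z : finType) (P : pred Z) : (0 < n)%N -> #|Z|%:R <= n%:R :> R ->
    \sum_(z | P z) expR (- mu * (a - - b)) <= n%:R * expR (- mu).
  move=> n0 Zn; rewrite opprK ab1 // mulr1 sumr_const -[leLHS]mulr_natl.
  rewrite ler_pM2r // (le_trans _ Zn) // ler_nat max_card //.
(* For a weight of mean 0 the linear terms of [expR_le_quad] cancel, which leaves the average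
   [1 + 2 * s ^+ 2]; [t] stands for [s] or [- s]. *)
have sum_le (c d : R) : #|X|%:R * c + #|Y|%:R * d = 0 -> `|c| <= 1 ->
    `|d| <= 1 -> forall t, `|t| = `|s| ->
    #|X|%:R * expR (t * c) + #|Y|%:R * expR (t * d) <= n%:R * m.
  move=> cd0 c1 d1 t ts.
  have quad (v : R) : `|v| <= 1 -> expR (t * v) <= 1 + t * v + 2 * s ^+ 2.
    move=> v1; have tv : `|t * v| <= `|s|.
      by rewrite normrM ts ler_piMr.
    apply: (le_trans (expR_le_quad _)).
      by rewrite (le_trans (ler_norm _)) // (le_trans tv).
    by rewrite lerD2l ler_pM2l ?ltr0n // -(real_normK (num_real s))
      -(real_normK (num_real (t * v))) lerXn2r ?nnegrE.
  have := ler_wpM2l (ler0n R #|X|) (quad c c1).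
  have := ler_wpM2l (ler0n R #|Y|) (quad d d1).
  have := ler_wpM2l n_ge0 m_ge.
  have -> : #|X|%:R * (1 + t * c + 2 * s ^+ 2) =
    #|X|%:R * (1 + 2 * s ^+ 2) + t * (#|X|%:R * c) by ring.
  have -> : #|Y|%:R * (1 + t * d + 2 * s ^+ 2) =
    #|Y|%:R * (1 + 2 * s ^+ 2) + t * (#|Y|%:R * d) by ring.
  have -> : #|Y|%:R * d = - (#|X|%:R * c) by lra.
  rewrite {1}/n natrD mulrDl mulrN; lra.
have mean0 : #|X|%:R * - b + #|Y|%:R * a = 0 by rewrite /a /b; ring.
have nb : `|- b| <= 1 by rewrite normrN ger0_norm; case/andP: b01.
have na : `|a| <= 1 by rewrite ger0_norm; case/andP: a01.
have npos (Z : finType) (z : Z) : (#|Z| <= n)%N -> (0 < n)%N.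
  by apply: leq_trans; apply/card_gt0P; exists z.
have Xn : (#|X| <= n)%N by rewrite leq_addr.
have Yn : (#|Y| <= n)%N by rewrite leq_addl.
have off_ge0 : 0 <= n%:R * expR (- mu) by rewrite mulr_ge0 // ltW.
(* The weights have mean 0 and increase by [a + b = 1] from the first block to
   the second one. *)
exists (fun p => match p with inl _ => - b | inr _ => a end).
rewrite card_sum; split.
- move=> [x|y]; rewrite big_sumType /=; apply: le_trans B_ge.
    rewrite [X in _ + X]big_pred0 ?addr0 => [|i]; last by rewrite eqxx.
    rewrite (le_trans (one_le _ x _ _ _ _)) ?lerDl // => z.
    by case: (x =P z) => [->|_] //; rewrite eqxx.
  rewrite addrC lerD ?off_le ?(npos _ y) //.
  by apply: (one_le _ y) => z; case: (y =P z) => [->|_] //; rewrite eqxx.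
- move=> [x|y]; rewrite big_sumType /=; apply: le_trans B_ge.
    rewrite lerD ?off_le ?(npos _ x) //.
    by apply: (one_le _ x) => z; case: (z =P x) => // _; rewrite eqxx.
  rewrite [X in X + _]big_pred0 ?add0r => [|i]; last by rewrite eqxx.
  rewrite (le_trans (one_le _ y _ _ _ _)) ?lerDl // => z.
  by case: (z =P y) => // _; rewrite eqxx.
- rewrite big_sumType /= !sumr_const -[X in X + _]mulr_natl -[X in _ + X]mulr_natl.
  exact: sum_le.
- rewrite big_sumType /= !sumr_const -[X in X + _]mulr_natl -[X in _ + X]mulr_natl.
  by apply: sum_le => //; rewrite normrN.
Qed.

Lemma split_bij (p q : nat) : bijective (@split p q).
Proof. by exists (@unsplit p q); [exact: splitK | exact: unsplitK]. Qed.

(* [[L1, 0], [C, L2]] = [[1, 0], [C L1^-1, 1]] * [[L1, 0], [0, L2]], and the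
   layers of [L1] and [L2] are merged pairwise, so each halving costs a single
   layer. *)
Lemma layered_trig (k p : nat) (L : 'M[F]_p) :
  (p <= 2 ^ k)%N -> 1 + (2 ^ k)%:R * expR (- mu) <= B ->
  is_trig_mx L -> L \in unitmx -> layered mu s k.+1 B m (fun i j => L i j).
Proof.
have m1 : 1 <= m.
  by rewrite (le_trans _ m_ge) // lerDl mulr_ge0 // sqr_ge0.
elim: k p L => [|k IH] p L p_le B_ge Ltrig Lunit.
  have B1 : 1 <= B.
    by rewrite (le_trans _ B_ge) // lerDl mulr_ge0 ?ler0n // expR_ge0.
  apply: layered1.
  have := @layer_monomial R F mu s B m _ id (fun i => L i i) B1 m1
    (fun _ _ => id).
  congr layer; apply/funext => i; apply/funext => j.
  rewrite (_ : j = i) ?eqxx ?mulr1 //.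
  by apply/val_inj; case: i j => i hi [j hj] /=; move: (p_le) => /=; lia.
have B_ge' : 1 + (2 ^ k)%:R * expR (- mu) <= B.
  rewrite (le_trans _ B_ge) // lerD2l ler_pM2r ?expR_gt0 // ler_nat.
  by rewrite leq_exp2l.
have [p1 [p2 [Ep p1_le p2_le]]] :
    exists p1 p2, [/\ p = (p1 + p2)%N, (p1 <= 2 ^ k)%N & (p2 <= 2 ^ k)%N].
  exists p./2, (p - p./2)%N; move: p_le; rewrite expnS; split; lia.
subst p; move: Ltrig Lunit; rewrite -(submxK L).
set L1 := ulsubmx L; set C := dlsubmx L; set L2 := drsubmx L => Ltrig Lunit.
have ur0 : ursubmx L = 0.
  apply/matrixP => i j; move/is_trig_mxP: Ltrig => /(_ (lshift p2 i) (rshift p1 j)).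
  rewrite block_mxEur mxE => -> //=; first by rewrite mxE.
  by rewrite (leq_trans (ltn_ord i)) // leq_addr.
move: Ltrig Lunit; rewrite ur0 is_trig_block_mx // eqxx /=.
move=> /andP[L1trig L2trig]; rewrite unitmxE det_lblock unitrM => /andP[L1u L2u].
have step : layered mu s k.+2 B m (kmul
    (kshear (fun i j => (C *m invmx L1) i j))
    (kdsum (fun i j => L1 i j) (fun i j => L2 i j))).
  exists (kshear (fun i j => (C *m invmx L1) i j)).
  exists (kdsum (fun i j => L1 i j) (fun i j => L2 i j)); split=> //.
    apply: layer_shear; rewrite (le_trans _ B_ge) // lerD2l.
    by rewrite ler_pM2r ?expR_gt0 // ler_nat !card_ord.
  by apply: layered_dsum; apply: IH.
have := layered_reindex (split_bij p1 p2) step.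
congr layered; apply/funext => i; apply/funext => j.
rewrite /kmul big_sumType /=.
case: (split_ordP i) => i' ->; case: (split_ordP j) => j' ->.
- rewrite block_mxEul /=.
  rewrite (bigD1 i') //= eqxx mul1r !big1 ?addr0 // => [z _|z].
    by rewrite mul0r.
  by rewrite eq_sym => /negPf ->; rewrite mul0r.
- rewrite block_mxEur /= mxE.
  by rewrite !big1 ?addr0 // => z _; rewrite ?mulr0 ?mul0r.
- rewrite block_mxEdl /=.
  rewrite [X in _ + X]big1 ?addr0 => [|z _]; last by rewrite mulr0.
  have -> : C i' j' = (C *m invmx L1 *m L1) i' j' by rewrite mulmxKV.
  by rewrite [RHS]mxE.
- rewrite block_mxEdr /=.
  rewrite big1 ?add0r => [|z _]; last by rewrite mulr0.
  rewrite (bigD1 i') //= eqxx mul1r !big1 ?addr0 // => z.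
  by rewrite eq_sym => /negPf ->; rewrite mul0r.
Qed.

(** An LUP decomposition gives one monomial layer for the permutation and [k.+1] layers for each
    triangular factor, the upper one being handled through its transpose. *)
Lemma layered_unitmx (k p : nat) (A : 'M[F]_p) :
  (p <= 2 ^ k)%N -> 1 + (2 ^ k)%:R * expR (- mu) <= B -> A \in unitmx ->
  layered mu s (1 + (k.+1 + k.+1)) B m (fun i j => A i j).
Proof.
move=> p_le B_ge Aunit.
have m1 : 1 <= m by rewrite (le_trans _ m_ge) // lerDl mulr_ge0 // sqr_ge0.
have B1 : 1 <= B.
  by rewrite (le_trans _ B_ge) // lerDl mulr_ge0 ?ler0n // expR_ge0.
case: p A p_le Aunit => [|p] A p_le Aunit.
  have idL K : layered mu s K B m (@kid F 'I_0).
    elim: K => [|K IH] //; exists (@kid F _), (@kid F _); split=> //.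
      have := @layer_monomial R F mu s B m _ id (fun _ : 'I_0 => 1) B1 m1
        (fun _ _ => id).
      by congr layer; apply/funext => -[].
    by rewrite kmul1k.
  by have := idL (1 + (k.+1 + k.+1))%N; congr layered; apply/funext => -[].
have := cormen_lup_correct A; have := cormen_lup_detL A.
have := cormen_lup_lower A; have := cormen_lup_upper A.
have := cormen_lup_perm A; case: cormen_lup => [[P L] U] /= /is_perm_mxP[sg ->].
move=> Uup Llow detL PA.
have Lunit : L \in unitmx by rewrite unitmxE detL unitr1.
have Uunit : U \in unitmx.
  have : perm_mx sg * A \in unitmx.
    by rewrite [_ * _]/(_ *m _) unitmx_mul unitmx_perm.
  by rewrite PA [_ * _]/(_ *m _) unitmx_mul => /andP[].
have Ltrig : is_trig_mx L.
  apply/is_trig_mxP => i j ij; rewrite Llow ?(ltnW ij) //.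
  by rewrite -val_eqE /= ltn_eqF.
have UTtrig : is_trig_mx U^T.
  by apply/is_trig_mxP => i j ij; rewrite mxE Uup.
have LL := layered_trig p_le B_ge Ltrig Lunit.
have := layered_trig p_le B_ge UTtrig.
rewrite unitmx_tr => /(_ Uunit) /layered_tr UL.
have PL : layered mu s 1 B m (fun i j : 'I_p.+1 => 1 * ((sg^-1)%g i == j)%:R : F).
  by apply: layered1; apply: layer_monomial => //; exact: perm_inj.
have := layered_comp PL (layered_comp LL UL).
congr layered; apply/funext => i; apply/funext => j.
have -> : A = perm_mx (sg^-1)%g *m (L *m U).
  have -> : L *m U = perm_mx sg *m A by exact: esym.
  by rewrite mulmxA -perm_mxM mulVg perm_mx1 mul1mx.
rewrite mxE; apply: eq_bigr => z _; rewrite mxE mul1r; congr (_ * _).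
  by rewrite !mxE.
by rewrite mxE; apply: eq_bigr => t _; rewrite mxE.
Qed.

End Triangular.

(** * From layers to sparse plus low rank *)

Lemma mxrank_row_support (F : fieldType) (a b : nat) (A : {set 'I_a})
    (M : 'M[F]_(a, b)) :
  (forall i j, i \notin A -> M i j = 0) -> (\rank M <= #|A|)%N.
Proof.
move=> M0.
pose P : 'M[F]_(a, #|A|) := \matrix_(i, k) (i == enum_val k)%:R.
pose Q : 'M[F]_(#|A|, b) := \matrix_(k, j) M (enum_val k) j.
have -> : M = P *m Q.
  apply/matrixP => i j; rewrite mxE.
  under eq_bigr => k _ do rewrite !mxE.
  have [iA|/M0 iA] := boolP (i \in A).
    rewrite (bigD1 (enum_rank_in iA i)) //= enum_rankK_in // eqxx mul1r big1.
      by rewrite addr0.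
    move=> k kne; case: eqP => [ik|_]; last by rewrite mul0r.
    by case/eqP: kne; apply: enum_val_inj; rewrite enum_rankK_in.
  rewrite iA big1 // => k _; case: eqP => [ik|_]; last by rewrite mul0r.
  by rewrite -ik iA mulr0.
exact: leq_trans (mxrankM_maxl _ _) (rank_leq_col _).
Qed.

Lemma mxrank_col_support (F : fieldType) (a b : nat) (A : {set 'I_b})
    (M : 'M[F]_(a, b)) :
  (forall i j, j \notin A -> M i j = 0) -> (\rank M <= #|A|)%N.
Proof.
move=> M0; rewrite -mxrank_tr; apply: mxrank_row_support => i j iA.
by rewrite mxE M0.
Qed.

Section Splitting.
Variables (R : realType) (F : fieldType).

Definition row_col_sparse (sg : R) (a b : nat) (S : 'M[F]_(a, b)) : Prop :=
  (forall i, #|[set j | S i j != 0]|%:R <= sg) /\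
  (forall j, #|[set i | S i j != 0]|%:R <= sg).

(** The bounds are real so that they can be multiplied freely; rounding to an integer happens only
    once, in [rigidity_le]. *)
Definition real_split (sg rho : R) (a b : nat) (M : 'M[F]_(a, b)) : Prop :=
  exists S L, [/\ M = S + L, row_col_sparse sg S & (\rank L)%:R <= rho].

Lemma support_mulmx (a b c : nat) (S : 'M[F]_(a, b)) (T : 'M[F]_(b, c))
    (sg tu : R) : 0 <= tu ->
  (forall i, #|[set j | S i j != 0]|%:R <= sg) ->
  (forall i, #|[set j | T i j != 0]|%:R <= tu) ->
  forall i, #|[set j | (S *m T) i j != 0]|%:R <= sg * tu.
Proof.
move=> tu0 Ssp Tsp i.
have sub : [set j | (S *m T) i j != 0] \subset
    \bigcup_(k in [set k | S i k != 0]) [set j | T k j != 0].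
  apply/subsetP => j; rewrite inE mxE => nz; apply/bigcupP.
  case: (pickP (fun k => S i k * T k j != 0)) => [k|none].
    by rewrite mulf_eq0 negb_or => /andP[Sk Tk]; exists k; rewrite inE.
  by move: nz; rewrite big1 ?eqxx // => k _; apply/eqP; rewrite -[_ == _]negbK none.
have card_le : (#|[set j | (S *m T) i j != 0%R]| <=
    \sum_(k in [set k | S i k != 0%R]) #|[set j | T k j != 0%R]|)%N.
  apply: leq_trans (subset_leq_card sub) _.
  apply: (big_ind2 (fun (A : {set 'I_c}) n => #|A| <= n)%N) => //.
    by rewrite cards0.
  move=> A n A' n' An An'; rewrite cardsU.
  exact: leq_trans (leq_subr _ _) (leq_add An An').
apply: (@le_trans _ _ (#|[set k | S i k != 0]|%:R * tu)).
  rewrite (le_trans (_ : _ <= (\sum_(k in [set k | S i k != 0%R])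
    #|[set j | T k j != 0%R]|)%N%:R)) ?ler_nat //.
  by rewrite natr_sum mulr_natl -sumr_const ler_sum.
by rewrite ler_wpM2r.
Qed.

Lemma row_col_sparse_mul (a b c : nat) (S : 'M[F]_(a, b)) (T : 'M[F]_(b, c))
    (sg tu : R) : 0 <= sg -> 0 <= tu ->
  row_col_sparse sg S -> row_col_sparse tu T ->
  row_col_sparse (sg * tu) (S *m T).
Proof.
move=> sg0 tu0 [Sr Sc] [Tr Tc]; split; first exact: support_mulmx.
move=> j; rewrite mulrC.
have tr (a' b' : nat) (U : 'M[F]_(a', b')) k :
    [set i | U i k != 0] = [set i | U^T k i != 0].
  by apply/setP => i; rewrite !inE mxE.
rewrite tr trmx_mul; apply: support_mulmx => // i; rewrite -tr //.
Qed.

(** All terms of the expanded product except [S *m S'] contain a low-rank factor. Grouping them as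
    [L *m (S' + L') + S *m L'] makes the ranks add while the sparsities multiply. *)
Lemma real_split_mul (a b c : nat) (M : 'M[F]_(a, b)) (M' : 'M[F]_(b, c))
    (sg tu r r' : R) : 0 <= sg -> 0 <= tu ->
  real_split sg r M -> real_split tu r' M' ->
  real_split (sg * tu) (r + r') (M *m M').
Proof.
move=> sg0 tu0 [S [L [-> Ssp Lr]]] [S' [L' [-> Ssp' Lr']]].
exists (S *m S'), (L *m (S' + L') + S *m L'); split.
- by rewrite mulmxDl [S *m (_ + _)]mulmxDr -addrA [X in _ + X = _]addrC.
- exact: row_col_sparse_mul.
- apply: le_trans (lerD Lr Lr'); rewrite -natrD ler_nat.
  apply: leq_trans (mxrank_add _ _) _.
  by rewrite leq_add ?mxrankM_maxl ?mxrankM_maxr.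
Qed.

Lemma real_split_sub (a b : nat) (M : 'M[F]_a) (f : 'I_b -> 'I_a) (sg r : R) :
  injective f -> real_split sg r M -> real_split sg r (mxsub f f M).
Proof.
move=> finj [S [L [-> [Sr Sc] Lr]]]; exists (mxsub f f S), (mxsub f f L); split.
- by apply/matrixP => i j; rewrite !mxE.
- split=> i.
    apply: le_trans (Sr (f i)); rewrite ler_nat -(card_imset _ finj).
    by apply/subset_leq_card/subsetP => _ /imsetP[j + ->]; rewrite !inE mxE.
  apply: le_trans (Sc (f i)); rewrite ler_nat -(card_imset _ finj).
  by apply/subset_leq_card/subsetP => _ /imsetP[j + ->]; rewrite !inE mxE.
- apply: le_trans Lr; rewrite ler_nat.
  have -> : mxsub f f L = rowsub f (rowsub f L^T)^T.
    by apply/matrixP => i j; rewrite !mxE.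
  apply: leq_trans (mxrankS (rowsub_sub _ _)) _.
  rewrite mxrank_tr; apply: leq_trans (mxrankS (rowsub_sub _ _)) _.
  by rewrite mxrank_tr.
Qed.

Lemma rigidity_le (n : nat) (M : 'M[F]_n) (r sg rho : R) :
  0 <= sg -> rho <= r -> real_split sg rho M ->
  (rigidity M r)%:R <= sg.
Proof.
move=> sg0 rho_le [S [L [-> [Sr Sc] Lr]]].
(* The rank bound forces [r] to be nonnegative, so the junk value of [rigidity] does not occur. *)
have r0 : 0 <= r by rewrite (le_trans _ rho_le) // (le_trans _ Lr).
have [_ minr] := rigidityP (S + L) r0.
have := minr (Num.truncn sg); rewrite truncn_ge_nat //; apply.
exists S, L; split=> //; last exact: le_trans rho_le.
by split=> k; rewrite truncn_ge_nat.
Qed.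

Definition mxof (X : finType) (f : X -> X -> F) : 'M[F]_#|X| :=
  \matrix_(i, j) f (enum_val i) (enum_val j).

Lemma mxof_mul (X : finType) (f g : X -> X -> F) :
  mxof (kmul f g) = mxof f *m mxof g.
Proof.
apply/matrixP => i j; rewrite !mxE /kmul.
under [RHS]eq_bigr => k _ do rewrite !mxE.
by rewrite (reindex _ (onW_bij _ (@enum_val_bij X))).
Qed.

Lemma card_enum_val_set (X : finType) (P : pred X) :
  #|[set j : 'I_#|X| | P (enum_val j)]| = #|[set x | P x]|.
Proof.
rewrite -(card_imset _ enum_val_inj); congr #|pred_of_set _|.
apply/setP => x; rewrite inE; apply/imsetP/idP => [[j + ->]|Px].
  by rewrite inE.
by exists (enum_rank x); rewrite ?inE enum_rankK.
Qed.

Variables (mu s : R).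
Hypotheses (mu_ge0 : 0 <= mu) (s_ge0 : 0 <= s).

(* Rows of weight above [D] and columns of weight below [- D] are few by
   Markov's inequality for [expR (s * w)]; between the others the weight drops
   by at most [2 * D], so the weighted count [B] bounds the actual one. *)
Lemma layer_split (B m D : R) (X : finType) (e : X -> X -> F) :
  layer mu s B m e -> 0 <= B ->
  real_split (B * expR (2 * mu * D)) (2 * (#|X|%:R * m * expR (- s * D)))
    (mxof e).
Proof.
move=> [w [wr wc wp wn]] B0.
pose hi x := D < w x; pose lo x := w x < - D.
pose S x y := if hi x || lo y then 0 else e x y.
have few (P : pred X) (v : X -> R) : (forall x, P x -> D <= v x) ->
    \sum_x expR (s * v x) <= #|X|%:R * m ->
    #|[set x | P x]|%:R <= #|X|%:R * m * expR (- s * D).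
  move=> Pv sv; have eD := expR_gt0 (s * D).
  rewrite mulNr expRN ler_pdivlMr // (le_trans _ sv) //.
  rewrite [leLHS]mulr_natl -sumr_const.
  rewrite (le_trans (_ : _ <= \sum_(x in [set x | P x]) expR (s * v x))) //.
    by apply: ler_sum => x; rewrite inE => /Pv Dv; rewrite ler_expR ler_wpM2l.
  rewrite [leRHS](bigID (fun x => x \in [set x | P x])) /= lerDl.
  by apply: sumr_ge0 => x _; exact: expR_ge0.
have count (P Q : pred X) (v : X -> R) : (forall x, P x -> Q x /\ v x <= 2 * D) ->
    \sum_(x | Q x) expR (- mu * v x) <= B ->
    #|[set x | P x]|%:R <= B * expR (2 * mu * D).
  move=> Pv sv; have eD := expR_gt0 (- (2 * mu * D)).
  rewrite -[expR _]invrK -expRN ler_pdivlMr // (le_trans _ sv) //.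
  rewrite [leLHS]mulr_natl -sumr_const.
  rewrite (le_trans (_ : _ <= \sum_(x in [set x | P x]) expR (- mu * v x))) //.
    apply: ler_sum => x; rewrite inE => /Pv[_ vD]; rewrite ler_expR.
    by rewrite mulNr lerN2 (mulrC 2) -mulrA ler_wpM2l.
  rewrite [leRHS](bigID (fun x => x \in [set x | P x])) /= -[leLHS]addr0.
  apply: lerD; last by apply: sumr_ge0 => x _; exact: expR_ge0.
  rewrite le_eqVlt; apply/orP; left; apply/eqP; apply: eq_bigl => x.
  by rewrite inE andb_idl // => /Pv[].
exists (mxof S), (mxof e - mxof S); split.
- by rewrite [RHS]addrC subrK.
- have close x y : S x y != 0 -> e x y != 0 /\ w x - w y <= 2 * D.
    rewrite /S /hi /lo; case: ifP => [_|]; first by rewrite eqxx.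
    by move=> /norP[]; rewrite -!leNgt => h1 h2 h3; split=> //; lra.
  split=> k.
    rewrite (_ : [set _ | _] = [set j : 'I_#|X| | S (enum_val k) (enum_val j) != 0]).
      rewrite (card_enum_val_set (fun y => S (enum_val k) y != 0)).
      by apply: count (wr (enum_val k)) => y; exact: close.
    by apply/setP => j; rewrite !inE mxE.
  rewrite (_ : [set _ | _] = [set j : 'I_#|X| | S (enum_val j) (enum_val k) != 0]).
    rewrite (card_enum_val_set (fun y => S y (enum_val k) != 0)).
    by apply: count (wc (enum_val k)) => y; exact: close.
  by apply/setP => j; rewrite !inE mxE.
(* [Lhi] takes the rows of weight above [D] whole, so what remains of the discarded part lives in
   the columns of weight below [- D]. *)
- pose Lhi : 'M[F]_#|X| := \matrix_(i, j)
    (if hi (enum_val i) then e (enum_val i) (enum_val j) else 0).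
  have -> : mxof e - mxof S = Lhi + (mxof e - mxof S - Lhi).
    by rewrite [RHS]addrC subrK.
  apply: (@le_trans _ _ (#|[set x | hi x]|%:R + #|[set x | lo x]|%:R)).
    rewrite -natrD ler_nat (leq_trans (mxrank_add _ _)) // leq_add //.
      rewrite -(card_enum_val_set hi); apply: mxrank_row_support => i j.
      by rewrite inE mxE => /negPf ->.
    rewrite -(card_enum_val_set lo); apply: mxrank_col_support => i j.
    rewrite inE !mxE /S => /negPf ->; rewrite orbF.
    by case: ifP => _; rewrite ?subr0 subrr.
  rewrite (_ : 2 * _ = #|X|%:R * m * expR (- s * D) + #|X|%:R * m * expR (- s * D)).
    apply: lerD; first by apply: (few _ w) => // x /ltW.
    apply: (few _ (fun x => - w x)) => [x /ltW|]; first by rewrite lerNr.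
    by move: wn; under eq_bigr => x _ do rewrite mulNr -mulrN.
  by rewrite mulrDl !mul1r.
Qed.

Lemma layered_split (B m D : R) (K : nat) (X : finType) (f : X -> X -> F) :
  layered mu s K B m f -> 0 <= B ->
  real_split ((B * expR (2 * mu * D)) ^+ K)
    (K%:R * (2 * (#|X|%:R * m * expR (- s * D)))) (mxof f).
Proof.
move=> fL B0; elim: K f fL => [|K IH] f /=.
  move=> ->; exists (mxof (@kid F X)), 0; rewrite addr0 mxrank0 mul0r; split=> //.
  have one (Y : finType) (y : Y) (P : pred Y) : (forall z, P z -> z = y) ->
      #|[set z | P z]|%:R <= (1 : R).
    move=> Py; rewrite -[leRHS]/(1%:R) ler_nat -(card1 y).
    by apply/subset_leq_card/subsetP => z; rewrite !inE => /Py ->.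
  split=> k; apply: (one _ k) => j; rewrite mxE /kid.
    by case: (enum_val k =P _) => [/enum_val_inj ->|_] //; rewrite eqxx.
  by case: (_ =P enum_val k) => [/enum_val_inj ->|_] //; rewrite eqxx.
move=> [e [g [eL gL ->]]]; rewrite mxof_mul exprS.
set r := 2 * (_ * _ * _); have -> : K.+1%:R * r = r + K%:R * r.
  by rewrite -natr1 mulrDl mul1r addrC.
have Be : 0 <= B * expR (2 * mu * D) by rewrite mulr_ge0 ?expR_ge0.
by apply: real_split_mul; rewrite ?exprn_ge0 //; [apply: layer_split | exact: IH].
Qed.

End Splitting.

(** * Toeplitz matrices inside group matrices *)

Lemma Vandermonde_unitmx (F : fieldType) (n : nat) (a : 'rV[F]_n) :
  injective (a 0) -> Vandermonde n a \in unitmx.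
Proof.
move=> a_inj; rewrite unitmxE det_Vandermonde unitfE.
apply/prodf_neq0 => i _; apply/prodf_neq0 => j ij.
by rewrite subr_eq0; apply: contraTneq ij => /a_inj ->; rewrite ltnn.
Qed.

(** As [n] is invertible, ['X^n - 1] is separable and has [n] distinct roots; that many [n]-th roots
    of unity must include a primitive one. *)
Lemma closed_prim_root_exists (F : closedFieldType) (n : nat) :
  (0 < n)%N -> n%:R != 0 :> F -> exists z : F, n.-primitive_root z.
Proof.
move=> n_gt0 n_neq0; pose p : {poly F} := 'X^n - 1.
have [r Dp] := closed_field_poly_normal p.
rewrite (monicP _) ?monicXnsubC // scale1r in Dp.
have rn1: all n.-unity_root r by apply/allP => z; rewrite -root_prod_XsubC -Dp.
have sz_r: (n < (size r).+1)%N.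
  by rewrite -(size_prod_XsubC r id) -Dp size_XnsubC.
have [|z] := hasP (has_prim_root n_gt0 rn1 _ sz_r); last by exists z.
by rewrite -separable_prod_XsubC -Dp separable_Xn_sub_1.
Qed.

Section Models.
Variables (R : realType) (F : fieldType) (mu s : R).

(** One pair [f], [g] serves all [T]; only the eigenvalues [l], a Fourier transform of [T] in the
    case of groups, depend on [T]. *)
Definition diagonalizes (X : finType) (dl : X -> X -> X) (f g : X -> X -> F) :=
  forall T : X -> F, exists l : X -> F,
    forall x y, T (dl x y) = \sum_c f x c * (l c * g c y).

(* [dl] plays the role of the difference of a finite abelian group [X] of
   order [Q], [f] and [g] of its character table and the inverse table, and
   [psi] of a map from the integers to the group; [E x y x' y'] is what
   [psi x - psi y = psi x' - psi y'] implies. *)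
Definition difference_model (K : nat) (B m : R) (Q : nat)
    (E : nat -> nat -> nat -> nat -> Prop) : Prop :=
  exists (X : finType) (dl : X -> X -> X) (f g : X -> X -> F) (psi : nat -> X),
    [/\ #|X| = Q, layered mu s K B m f, layered mu s K B m g,
        diagonalizes dl f g &
        forall x y x' y', dl (psi x) (psi y) = dl (psi x') (psi y') ->
          E x y x' y'].

Lemma difference_model_weaken (K : nat) (B m : R) (Q : nat)
    (E E' : nat -> nat -> nat -> nat -> Prop) :
  (forall x y x' y', E x y x' y' -> E' x y x' y') ->
  difference_model K B m Q E -> difference_model K B m Q E'.
Proof.
move=> EE' [X [dl [f [g [psi [cX fL gL fg psiE]]]]]].
exists X, dl, f, g, psi; split=> // x y x' y' /psiE; exact: EE'.
Qed.

(** Diagonalize in the first coordinate with the second one fixed; each eigenvalue is then a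
    function on [Y] and is diagonalized in turn. *)
Lemma diagonalizes_prod (X Y : finType) (dX : X -> X -> X) (dY : Y -> Y -> Y)
    (f g : X -> X -> F) (f' g' : Y -> Y -> F) :
  diagonalizes dX f g -> diagonalizes dY f' g' ->
  diagonalizes (fun p q => (dX p.1 q.1, dY p.2 q.2)) (ktens f f') (ktens g g').
Proof.
move=> fg fg' T.
have /choice[l lP] := fun z => fg (fun x => T (x, z)).
have /choice[l' lP'] := fun c => fg' (fun z => l z c).
exists (fun c => l' c.1 c.2) => -[x1 x2] [y1 y2] /=; rewrite lP.
transitivity (\sum_c \sum_d
    ktens f f' (x1, x2) (c, d) * (l' c d * ktens g g' (c, d) (y1, y2))).
  apply: eq_bigr => c _; rewrite lP' mulr_suml mulr_sumr.
  by apply: eq_bigr => d _; rewrite /ktens /=; ring.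
by rewrite pair_bigA; apply: eq_bigr => -[].
Qed.

(** The maps [h] and [h'] say what each factor sees of an integer: the integer itself for Chinese
    remaindering, the last digit and the remaining ones for base [d]. *)
Lemma difference_model_prod (K : nat) (B m B' m' : R) (Q Q' : nat)
    (E E' : nat -> nat -> nat -> nat -> Prop) (h h' : nat -> nat) :
  difference_model K B m Q E -> difference_model K B' m' Q' E' ->
  difference_model K (B * B') (m * m') (Q * Q') (fun x y x' y' =>
    E (h x) (h y) (h x') (h y') /\ E' (h' x) (h' y) (h' x') (h' y')).
Proof.
move=> [X [dX [f [g [psi [cX fL gL fg psiE]]]]]].
move=> [Y [dY [f' [g' [psi' [cY fL' gL' fg' psiE']]]]]].
exists (X * Y)%type, (fun p q => (dX p.1 q.1, dY p.2 q.2)).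
exists (ktens f f'), (ktens g g'), (fun x => (psi (h x), psi' (h' x))).
split.
- by rewrite card_prod cX cY.
- exact: layered_tens.
- exact: layered_tens.
- exact: diagonalizes_prod.
- by move=> x y x' y' [/psiE ? /psiE' ?].
Qed.

Lemma layered_id (K : nat) (B m : R) (X : finType) :
  1 <= B -> 1 <= m -> layered mu s K B m (@kid F X).
Proof.
move=> B1 m1; elim: K => [|K IH] //; exists (@kid F X), (@kid F X).
split=> //; last by rewrite kmul1k.
have := @layer_monomial R F mu s B m X id (fun=> 1) B1 m1 (fun _ _ => id).
by congr layer; apply/funext => x; apply/funext => y; rewrite mul1r.
Qed.

Lemma difference_model_unit (K : nat) :
  difference_model K 1 1 1 (fun _ _ _ _ => True).
Proof.
exists unit, (fun _ _ => tt), (@kid F _), (@kid F _), (fun=> tt).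
split=> //; [exact: card_unit | exact: layered_id | exact: layered_id |].
move=> T; exists (fun=> T tt) => -[] []; rewrite (bigD1 tt) //= big1.
  by rewrite /kid eqxx mul1r mulr1 addr0.
by case.
Qed.

Section Cyclic.
Variables (k : nat) (B m : R).
Hypotheses (s_small : `|s| <= 1 / 2)
  (B_ge : 1 + (2 ^ k)%:R * expR (- mu) <= B)
  (m_ge : 1 + 2 * s ^+ 2 <= m).

Lemma difference_model_cyclic (q : nat) (w : F) :
  q.-primitive_root w -> (q <= 2 ^ k)%N ->
  difference_model (1 + (k.+1 + k.+1)) B m q
    (fun x y x' y' => x + y' = x' + y %[mod q])%N.
Proof.
move=> w_prim q_le; have := prim_order_gt0 w_prim.
case: q => // q in w_prim q_le * => _.
(* The Vandermonde matrices of the powers of [w] and of its inverse are the character table of the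
   cyclic group and its conjugate. *)
pose a : 'rV[F]_q.+1 := \row_c w ^+ c.
pose b : 'rV[F]_q.+1 := \row_c w^-1 ^+ c.
have a_inj : injective (a 0).
  move=> c d; rewrite !mxE => /eqP; rewrite (eq_prim_root_expr w_prim).
  by rewrite !modn_small // => /eqP /val_inj.
have b_inj : injective (b 0).
  move=> c d; rewrite !mxE !exprVn => /invr_inj cd; apply: a_inj.
  by rewrite !mxE.
have w_unit : w \is a GRing.unit.
  rewrite unitfE; apply/eqP => w0; have := prim_expr_order w_prim.
  by move/eqP; rewrite w0 exprS mul0r eq_sym oner_eq0.
exists 'I_q.+1, (fun x y : 'I_q.+1 => inZp (x + (q.+1 - y))).
exists (fun x c => Vandermonde q.+1 a x c), (fun c y => Vandermonde q.+1 b y c).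
exists inZp; split.
- exact: card_ord.
- by apply: layered_unitmx => //; exact: Vandermonde_unitmx.
- by apply: layered_tr; apply: layered_unitmx => //; exact: Vandermonde_unitmx.
- move=> T; pose V := Vandermonde q.+1 a.
  pose Tc : 'cV[F]_q.+1 := \col_z T z.
  exists (fun c => (invmx V *m Tc) c 0) => x y.
  have -> z : T z = (V *m (invmx V *m Tc)) z 0.
    by rewrite mulmxA mulmxV ?mul1mx ?mxE // Vandermonde_unitmx.
  rewrite mxE; apply: eq_bigr => c _; set lc := (_ *m Tc) c 0.
  rewrite (mulrC lc) mulrA; congr (_ * lc).
  have w_mod n : w ^+ (c * (n %% q.+1)) = w ^+ (c * n).
    by rewrite -(prim_expr_mod w_prim) modnMmr (prim_expr_mod w_prim).
  rewrite !mxE -!exprM /=. rewrite w_mod.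
  have y_le : (y <= q.+1)%N by rewrite ltnW.
  apply: (mulIr (unitrX (c * y) w_unit)).
  have w_c : w ^+ (c * q.+1) = 1.
    by rewrite mulnC exprM (prim_expr_order w_prim) expr1n.
  rewrite -exprD -mulnDr -addnA subnK // mulnDr exprD w_c mulr1.
  by rewrite exprVn -[RHS]mulrA mulVr ?unitrX // mulr1.
- move=> x y x' y' /(congr1 val) /=.
  move: (ltn_pmod y (ltn0Sn q)) (ltn_pmod y' (ltn0Sn q)) => hy hy' e.
  have {}e : (x %% q.+1 + (q.+1 - y %% q.+1) =
              x' %% q.+1 + (q.+1 - y' %% q.+1) %[mod q.+1])%N by exact: e.
  move/eqP: e; rewrite -(eqn_modDr (y %% q.+1 + y' %% q.+1)).
  rewrite (_ : (_ + _ = x %% q.+1 + y' %% q.+1 + q.+1)%N); last by lia.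
  rewrite (_ : (x' %% _ + _ + _ = x' %% q.+1 + y %% q.+1 + q.+1)%N); last by lia.
  by rewrite !modnDr !modnDm => /eqP.
Qed.

Lemma difference_model_crt (qs : seq nat) :
  (forall q, q \in qs -> (q <= 2 ^ k)%N /\ exists w : F, q.-primitive_root w) ->
  pairwise coprime qs ->
  difference_model (1 + (k.+1 + k.+1)) (B ^+ size qs) (m ^+ size qs)
    (\prod_(q <- qs) q)
    (fun x y x' y' => x + y' = x' + y %[mod \prod_(q <- qs) q])%N.
Proof.
elim: qs => [|q qs IH] qsP /=.
  move=> _; rewrite !expr0 big_nil.
  apply: difference_model_weaken (difference_model_unit _).
  by move=> *; rewrite !modn1.
move=> /andP[q_cop qs_cop]; rewrite big_cons !exprS.
have [q_le [w w_prim]] := qsP q (mem_head _ _).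
have IHq : forall q0, q0 \in qs ->
    (q0 <= 2 ^ k)%N /\ exists w : F, q0.-primitive_root w.
  by move=> q0 q0s; apply: qsP; rewrite in_cons q0s orbT.
have := difference_model_prod id id (difference_model_cyclic w_prim q_le)
  (IH IHq qs_cop).
apply: difference_model_weaken => x y x' y' [/eqP e1 /eqP e2].
apply/eqP; rewrite chinese_remainder ?e1 ?e2 //.
rewrite big_seq; apply: (big_ind (coprime q)) => [|u v cu cv|i iqs].
    exact: coprimen1.
  by rewrite coprimeMr cu.
exact: (allP q_cop).
Qed.

End Cyclic.

(** A sum of two digits is at most [2 * d - 2 < Q], so a congruence modulo [Q] between such sums is
    an equality. Comparing digit by digit thus involves no carries. *)
Lemma difference_model_digits (K : nat) (B m : R) (Q d n : nat) :
  (0 < d)%N -> (2 * d <= Q.+1)%N ->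
  difference_model K B m Q (fun x y x' y' => x + y' = x' + y %[mod Q])%N ->
  difference_model K (B ^+ n) (m ^+ n) (Q ^ n) (fun x y x' y' =>
    x < d ^ n -> y < d ^ n -> x' < d ^ n -> y' < d ^ n ->
    x + y' = x' + y)%N.
Proof.
move=> d_gt0 dQ modelQ; elim: n => [|n IH].
  rewrite !expr0 expn0; apply: difference_model_weaken (difference_model_unit _).
  by move=> x y x' y' _; rewrite !expn0; lia.
rewrite !exprS expnS.
have := difference_model_prod (fun x => x %% d)%N (fun x => x %/ d)%N modelQ IH.
apply: difference_model_weaken => x y x' y' [low high] hx hy hx' hy'.
have div_lt z : (z < d ^ n.+1 -> z %/ d < d ^ n)%N.
  by move=> hz; rewrite ltn_divLR // mulnC -expnS.
have {}high := high (div_lt _ hx) (div_lt _ hy) (div_lt _ hx') (div_lt _ hy').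
have mod_lt z : (z %% d < d)%N by rewrite ltn_mod.
have {}low : (x %% d + y' %% d = x' %% d + y %% d)%N.
  have sum_lt u v : (u %% d + v %% d < Q)%N.
    rewrite -ltnS; apply: leq_trans dQ.
    by rewrite mul2n -addnn -addSn -addnS leq_add.
  by move: low; rewrite (modn_small (sum_lt _ _)) (modn_small (sum_lt _ _)).
rewrite (divn_eq x d) (divn_eq y d) (divn_eq x' d) (divn_eq y' d).
by rewrite addnACA -mulnDl high low mulnDl addnACA.
Qed.

Lemma toeplitz_split (K : nat) (B m D : R) (Q N : nat) (M : 'M[F]_N) :
  0 <= mu -> 0 <= s -> 1 <= B -> 1 <= m ->
  difference_model K B m Q (fun x y x' y' =>
    x < N -> y < N -> x' < N -> y' < N -> x + y' = x' + y)%N ->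
  toeplitz M ->
  real_split ((B * expR (2 * mu * D)) ^+ (K + (1 + K)))
    ((K + (1 + K))%:R * (2 * (Q%:R * m * expR (- s * D)))) M.
Proof.
move=> mu0 s0 B1 m1 [X [dl [f [g [psi [cX fL gL fg psiE]]]]]] Mtoep.
(* [T] reads the entry of [M] at any pair of indices with difference [z]; as [M] is Toeplitz, the
   choice of the pair does not matter. Differences that do not occur get 0. *)
pose T z := if [pick p : 'I_N * 'I_N | dl (psi p.1) (psi p.2) == z] is Some p
  then M p.1 p.2 else 0.
have TM (i j : 'I_N) : T (dl (psi i) (psi j)) = M i j.
  rewrite /T; case: pickP => [[i' j'] /= /eqP e|/(_ (i, j))]; last by rewrite eqxx.
  apply: Mtoep; have := psiE _ _ _ _ e (ltn_ord _) (ltn_ord _) (ltn_ord _) (ltn_ord _).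
  by lia.
have [l lP] := fg T.
pose diag (x y : X) := l x * (x == y)%:R.
have diagL : layered mu s 1 B m diag.
  by apply: layered1; apply: (@layer_monomial _ _ _ _ _ _ _ id).
have hL := layered_comp fL (layered_comp diagL gL).
have psi_inj (i j : 'I_N) : psi i = psi j -> i = j.
  move=> e; apply: val_inj.
  have := psiE i i j i; rewrite e => /(_ erefl); rewrite !ltn_ord.
  by move=> /(_ isT isT isT isT) /addIn.
have iota_inj : injective (fun i : 'I_N => enum_rank (psi i)).
  by move=> i j /enum_rank_inj /psi_inj.
have := real_split_sub iota_inj (layered_split mu0 s0 D hL (le_trans ler01 B1)).
rewrite -cX; congr real_split; apply/matrixP => i j; rewrite !mxE !enum_rankK -TM lP.
rewrite /kmul; apply: eq_bigr => c _; congr (_ * _).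
rewrite (bigD1 c) //= /diag eqxx mulr1 big1 ?addr0 // => z.
by rewrite eq_sym => /negPf ->; rewrite mulr0 mul0r.
Qed.

End Models.

(** * Primes between 2 ^ j and 4 ^ j *)

Section Chebyshev.
Local Open Scope nat_scope.

Lemma exp2_le_central_bin (n : nat) : 2 ^ n <= 'C(n.*2, n).
Proof.
elim: n => [|n IH] //; rewrite doubleS binS expnS.
have -> : 'C(n.*2.+1, n.+1) = 'C(n.*2.+1, n).
  rewrite -(@bin_sub n.*2.+1 n); last by rewrite -addnn leqW // leq_addr.
  by congr 'C(_, _); lia.
rewrite addnn -mul2n leq_mul2l /= (leq_trans IH) //.
by case: n {IH} => // n; rewrite binS leq_addr.
Qed.

(** By Legendre's formula each [p ^ k] contributes [n.*2 %/ p ^ k] minus twice [n %/ p ^ k], which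
    is at most 1, and 0 once [p ^ k] exceeds [n.*2]. *)
Lemma logn_central_bin (p n : nat) : prime p -> 0 < n ->
  logn p 'C(n.*2, n) <= trunc_log p n.*2.
Proof.
move=> p_pr n_gt0; set t := trunc_log p n.*2.
have le_sum (a b : nat) (f g h : nat -> nat) :
    (forall k, f k <= g k + h k) -> \sum_(a <= k < b) f k <=
    \sum_(a <= k < b) g k + \sum_(a <= k < b) h k.
  by move=> fgh; rewrite -big_split leq_sum.
have n_le : n <= n.*2 by rewrite -addnn leq_addr.
have := congr1 (logn p) (bin_fact n_le).
have -> : n.*2 - n = n by lia.
rewrite !lognM ?muln_gt0 ?fact_gt0 ?bin_gt0 // !logn_fact // => eq_log.
have ext : \sum_(1 <= k < n.*2.+1) n %/ p ^ k <= \sum_(1 <= k < n.+1) n %/ p ^ k.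
  rewrite (@big_cat_nat _ _ _ n.+1) //= ?ltnS //.
  rewrite -[leqRHS]addn0 leq_add2l big_nat_cond big1 // => k.
  move=> /andP[/andP[nk _] _].
  by rewrite divn_small // (leq_trans _ (ltn_expl _ (prime_gt1 p_pr))) // ltnW.
have cnt : \sum_(1 <= k < n.*2.+1) (k <= t) <= t.
  have [tn|tn] := leqP t.+1 n.*2.+1.
    rewrite (@big_cat_nat _ _ _ t.+1) //= -[leqRHS]addn0 leq_add //.
      apply: leq_trans (_ : \sum_(1 <= k < t.+1) 1 <= _); last first.
        by rewrite sum_nat_const_nat muln1; lia.
      by apply: leq_sum => k _; case: (k <= t).
    rewrite big_nat_cond big1 // => k /andP[/andP[tk _] _].
    by rewrite leqNgt tk.
  apply: leq_trans (_ : \sum_(1 <= k < n.*2.+1) 1 <= _); last first.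
    by rewrite sum_nat_const_nat muln1; lia.
  by apply: leq_sum => k _; case: (k <= t).
have := @le_sum 1 n.*2.+1 (fun k => n.*2 %/ p ^ k)
  (fun k => n %/ p ^ k + n %/ p ^ k) (fun k => nat_of_bool (k <= t)).
rewrite big_split /= => /(_ _)/wrap[k|]; last by lia.
have q_gt0 : 0 < p ^ k by rewrite expn_gt0 prime_gt0.
have [kt|kt] := leqP k t.
  rewrite -ltnS ltn_divLR //.
  have := ltn_ceil n q_gt0; set a := n %/ p ^ k => n_lt.
  rewrite (_ : (a + a + true).+1 = a.+1 + a.+1); last by lia.
  by rewrite mulnDl -addnn -addnS leq_add // ltnW.
rewrite divn_small // ltnNge; apply: contraL kt => kn.
by rewrite -leqNgt /t trunc_log_max // prime_gt1.
Qed.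

Definition primes_upto (n : nat) := [seq p <- iota 0 n.+1 | prime p].

Lemma central_bin_le (n : nat) : 0 < n ->
  'C(n.*2, n) <= n.*2 ^ size (primes_upto n.*2).
Proof.
move=> n_gt0; set c := 'C(n.*2, n).
have c_gt0 : 0 < c by rewrite bin_gt0 -addnn leq_addr.
have n2_gt0 : 0 < n.*2 by rewrite double_gt0.
have pow_le p : prime p -> p ^ logn p c <= n.*2.
  move=> p_pr; apply: leq_trans (trunc_logP (prime_gt1 p_pr) n2_gt0).
  by rewrite leq_exp2l ?prime_gt1 // logn_central_bin.
have size_le : size (primes c) <= size (primes_upto n.*2).
  apply: uniq_leq_size (primes_uniq _) _ => p.
  rewrite mem_filter mem_iota mem_primes add0n ltnS => /and3P[p_pr _ p_dvd].
  rewrite p_pr /= (leq_trans _ (pow_le p p_pr)) //.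
  rewrite -[leqLHS]expn1 leq_exp2l ?prime_gt1 //.
  by rewrite -pfactor_dvdn // expn1.
rewrite [leqLHS](prod_prime_decomp c_gt0) prime_decompE big_map /=.
apply: (@leq_trans (n.*2 ^ size (primes c))); last by rewrite leq_pexp2l.
have : {in primes c, forall p, prime p}.
  by move=> p; rewrite mem_primes => /andP[].
elim: (primes c) => [|p ps IH] ps_pr; first by rewrite big_nil.
rewrite big_cons /= expnS leq_mul //; first by rewrite pow_le ?ps_pr ?mem_head.
by apply: IH => q qs; rewrite ps_pr // in_cons qs orbT.
Qed.

Lemma exp2_ge_pow4 (j : nat) : 20 <= j -> 4 * j ^ 4 <= 2 ^ j.
Proof.
move=> j20; rewrite -(subnK j20); elim: (j - 20) => [|i IH].
  by rewrite add0n; lia.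
rewrite addSn [2 ^ _]expnS.
apply: leq_trans (_ : 2 * (4 * (i + 20) ^ 4) <= _); last by rewrite leq_mul2l.
rewrite !expnS expn0; nia.
Qed.

(** The lower end makes the product of these primes at least [2 ^ j] to the power of their number;
    the upper end bounds the halving depth by [j.*2]. *)
Definition primes_between (j : nat) :=
  [seq p <- iota (2 ^ j) (4 ^ j - 2 ^ j).+1 | prime p].

(** With [n.*2 = 4 ^ j], the bounds on the central binomial give [4 ^ j] at most [4 * j] times the
    number of primes up to [4 ^ j]. At most [2 ^ j] of these are below [2 ^ j]; fewer than [j ^ 3]
    others would give [2 ^ j <= 4 * j], which is false. *)
Lemma size_primes_between (c j : nat) : 20 <= j -> c <= j ->
  c * j ^ 2 <= size (primes_between j).
Proof.
move=> j20 cj; set n := 2 ^ (j.*2.-1).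
have n_gt0 : 0 < n by rewrite expn_gt0.
have n2 : n.*2 = 4 ^ j.
  by rewrite /n -mul2n -expnS prednK ?double_gt0 ?(leq_trans _ j20) // -muln2
    mulnC expnM.
have two_le4 : 2 ^ j <= 4 ^ j by rewrite leq_exp2r ?(leq_trans _ j20).
have upto : size (primes_upto n.*2) <= 2 ^ j + size (primes_between j).
  rewrite /primes_upto /primes_between n2.
  have -> : (4 ^ j).+1 = 2 ^ j + (4 ^ j - 2 ^ j).+1 by lia.
  rewrite iotaD add0n filter_cat size_cat leq_add2r.
  by rewrite size_filter (leq_trans (count_size _ _)) // size_iota.
have : 2 ^ n <= 2 ^ (j.*2 * size (primes_upto n.*2)).
  apply: leq_trans (exp2_le_central_bin n) _.
  apply: leq_trans (central_bin_le n_gt0) _.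
  by rewrite expnM n2 -[j.*2]muln2 mulnC expnM.
rewrite leq_exp2l // => n_le.
have n_sq : n.*2 = 2 ^ j * 2 ^ j by rewrite n2 -expnMn.
have big_pow := exp2_ge_pow4 j20.
rewrite leqNgt; apply/negP => b_lt.
have b_lt3 : size (primes_between j) < j ^ 3.
  by rewrite (leq_trans b_lt) // [leqRHS]expnS leq_mul2r cj orbT.
have jb : 4 * j * size (primes_between j) < 2 ^ j.
  apply: leq_trans big_pow; rewrite [j ^ 4]expnS mulnA ltn_pmul2l //.
  by rewrite muln_gt0 /= (leq_trans _ j20).
have sq_le : 2 ^ j * 2 ^ j <= 4 * j * 2 ^ j + 4 * j * size (primes_between j).
  rewrite -mulnDr -n_sq (leq_trans _ (_ : 2 * (j.*2 * size (primes_upto n.*2)) <= _)) //.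
    by rewrite -[leqLHS]mul2n leq_mul2l n_le.
  by rewrite -[j.*2]mul2n !mulnA leq_mul2l upto orbT.
have : 2 ^ j * 2 ^ j < (4 * j).+1 * 2 ^ j.
  by rewrite (leq_ltn_trans sq_le) // mulSn addnC ltn_add2r.
rewrite ltn_pmul2r ?expn_gt0 // ltnS leqNgt => /negP[].
apply: leq_trans big_pow; rewrite ltn_pmul2l // -[ltnLHS]expn1 ltn_exp2l //.
exact: leq_trans j20.
Qed.



End Chebyshev.

Lemma mem_primes_between (j p : nat) :
  p \in primes_between j -> [/\ prime p, (2 ^ j <= p)%N & (p <= 4 ^ j)%N].
Proof.
rewrite mem_filter mem_iota => /andP[p_pr /andP[p_ge p_lt]]; split=> //.
have : (2 ^ j <= 4 ^ j)%N by case: j {p_ge p_lt} => // j; rewrite leq_exp2r.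
lia.
Qed.

Lemma pairwise_coprime_primes (ps : seq nat) :
  uniq ps -> all prime ps -> pairwise coprime ps.
Proof.
elim: ps => //= p ps IH /andP[p_notin ps_uniq] /andP[p_pr ps_pr].
rewrite IH // andbT; apply/allP => q q_in.
have q_pr := allP ps_pr _ q_in; rewrite prime_coprime // dvdn_prime2 //.
by apply/eqP => pq; move: p_notin; rewrite pq q_in.
Qed.

Lemma expn_le_prod (a : nat) (qs : seq nat) :
  (forall q, q \in qs -> a <= q)%N -> (a ^ size qs <= \prod_(q <- qs) q)%N.
Proof.
elim: qs => [|q qs IH] qs_ge /=; first by rewrite big_nil.
rewrite big_cons expnS leq_mul ?qs_ge ?mem_head // IH // => q' q'_in.
by rewrite qs_ge // in_cons q'_in orbT.
Qed.

(** * Choice of the parameters and the rigidity bound *)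

Lemma toeplitz_split_digits (R : realType) (F : closedFieldType) (s : R)
    (j n d N : nat) (M : 'M[F]_N) (Q := (\prod_(q <- primes_between j) q)%N)
    (u := (n * size (primes_between j))%N%:R : R) :
  (forall p, prime p -> p%:R != 0 :> F) ->
  0 <= s -> s <= 1 / 2 -> (0 < d)%N -> (2 * d <= Q.+1)%N -> (N <= d ^ n)%N ->
  toeplitz M ->
  real_split (expR ((8 * j + 7)%:R * (u * (expR (- (2 * j%:R)) + 24 * j%:R * s))))
    ((8 * j + 7)%:R * (2 * ((Q ^ n)%N%:R * expR (- (u * s ^+ 2))))) M.
Proof.
move=> charF s_ge0 s_le d_gt0 dQ N_le Mtoep.
(* With this [mu], the [2 ^ j.*2] possible entries of a row contribute at most
   [expR (- (2 * j%:R))]. Writing [B] and [m] as exponentials turns their powers into multiples of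
   [u]. *)
pose mu : R := 4 * j%:R; pose B := expR (expR (- (2 * j%:R : R))).
pose m := expR (2 * s ^+ 2); pose ps := primes_between j.
have s_small : `|s| <= 1 / 2 by rewrite ger0_norm.
have mu_ge0 : 0 <= mu by rewrite mulr_ge0.
have m_ge : 1 + 2 * s ^+ 2 <= m by exact: expR_ge1Dx.
have B_ge : 1 + (2 ^ j.*2)%:R * expR (- mu) <= B.
  apply: le_trans (expR_ge1Dx _); rewrite lerD2l.
  rewrite (_ : - mu = - (2 * j%:R) + - (2 * j%:R)); last by rewrite /mu; ring.
  rewrite expRD mulrA ler_piMl ?expR_ge0 // expRN ler_pdivrMr ?expR_gt0 // mul1r.
  rewrite natrX (_ : 2 * j%:R = j.*2%:R * 1).
    rewrite expRM_natl lerXn2r ?nnegrE ?expR_ge0 //.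
    by rewrite (le_trans _ (expR_ge1Dx 1)).
  by rewrite mulr1 -mul2n natrM.
have psP p : p \in ps -> (p <= 2 ^ j.*2)%N /\ exists w : F, p.-primitive_root w.
  move=> /mem_primes_between[p_pr _ p_le]; split.
    by rewrite -mul2n expnM.
  by apply: closed_prim_root_exists; [exact: prime_gt0 | exact: charF].
have ps_coprime : pairwise coprime ps.
  apply: pairwise_coprime_primes; first by rewrite filter_uniq ?iota_uniq.
  exact: filter_all.
have model := difference_model_digits n d_gt0 dQ
  (difference_model_crt s_small B_ge m_ge psP ps_coprime).
have B1 : 1 <= B by rewrite (le_trans _ (expR_ge1Dx _)) // lerDl expR_ge0.
have m1 : 1 <= m by rewrite (le_trans _ m_ge) // lerDl mulr_ge0 // sqr_ge0.
(* The threshold [3 * (u * s)] leaves [2 - 3 = -1] times [u * s ^+ 2] in the exponent of the rank,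
   and adds [2 * mu * (3 * (u * s))], that is [24 * j%:R * (u * s)], to that of the sparsity. *)
have := @toeplitz_split R F mu s _ _ _ (3 * (u * s)) _ N M mu_ge0 s_ge0
  (exprn_ege1 n (exprn_ege1 _ B1)) (exprn_ege1 n (exprn_ege1 _ m1))
  (difference_model_weaken _ model) Mtoep.
move=> /(_ _)/wrap[|].
  move=> x y x' y' E hx hy hx' hy'.
  by apply: E; rewrite (leq_trans _ N_le).
have natK : (1 + (j.*2.+1 + j.*2.+1) + (1 + (1 + (j.*2.+1 + j.*2.+1))) =
  8 * j + 7)%N by lia.
rewrite natK -/Q -!exprM -!expRM_natl.
have usz : (size ps * n)%:R = u by rewrite mulnC.
rewrite usz -expRD -expRM_natl.
rewrite (_ : u * expR _ + _ = u * (expR (- (2 * j%:R)) + 24 * j%:R * s)).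
  rewrite (_ : _ * expR (u * _) * _ = (Q ^ n)%:R * expR (- (u * s ^+ 2))) //.
  by rewrite -mulrA -expRD; congr (_ * expR _); ring.
by rewrite /mu; ring.
Qed.

Lemma circulant_toeplitz (F : fieldType) (n : nat) (M : 'M[F]_n) :
  circulant M -> toeplitz M.
Proof.
move=> Mcirc i j k l ij; apply: Mcirc.
by rewrite -[j%:Z - i%:Z]opprB ij opprB.
Qed.

Lemma leq_mul_pred (a b : nat) :
  (1 < a -> 1 < b -> a * b <= 4 * (a.-1 * b.-1))%N.
Proof.
move=> a_gt1 b_gt1; rewrite -[4%N]/(2 * 2)%N mulnACA.
by apply: leq_mul; lia.
Qed.

Lemma double_uphalf_bounds (q : nat) :
  (2 * q.+1./2 <= q.+1)%N /\ (q <= 2 * q.+1./2)%N.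
Proof. lia. Qed.

Lemma half_le_ln2 (R : realType) : 1 / 2 <= ln 2 :> R.
Proof.
rewrite -ler_expR lnK ?posrE //; apply: le_trans (expR_le_quad _) _ => //.
lra.
Qed.

Local Open Scope complex_scope.

Theorem theorem5p3 (R : realType) (eps : R) (eps_gt0 : 0 < eps)
    (eps_lt : eps < 1 / 100) :
  exists N0 : nat, forall N : nat, (N0 <= N)%N -> forall M : 'M[R[i]]_N,
    circulant M \/ toeplitz M ->
    (rigidity M (N%:R / expR (eps ^+ 6 * ln N%:R `^ (35 / 100))))%:R
      <= N%:R `^ (15 * eps).
Proof.
have eps_le1 : eps <= 1 by lra.
have eps2_gt0 : 0 < eps ^+ 2 by exact: exprn_gt0.
(* Here [300 * 400] is 3 times the square of the 200 in [s], so that [t >= c * j ^ 2] yields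
   [u * s ^+ 2 >= 3 * n]. Taking [j = c + 20] meets both conditions of [size_primes_between]. *)
pose c := Num.bound (300 * 400 / eps ^+ 2); pose j := (c + 20)%N.
have c_gt : 300 * 400 / eps ^+ 2 < c%:R.
  by apply: archi_boundP; rewrite divr_ge0 ?mulr_ge0 // ltW.
have jr_ge : 20 + c%:R = j%:R :> R by rewrite natrD addrC.
have c_ge0 : 0 <= c%:R :> R by exact: ler0n.
have jr_gt0 : 0 < j%:R :> R by lra.
set t := size (primes_between j).
have t_ge : (c * j ^ 2 <= t)%N.
  by apply: size_primes_between; rewrite /j ?leq_addl ?leq_addr.
pose Q := (\prod_(q <- primes_between j) q)%N; pose d := Q.+1./2.
have c_gt0 : (0 < c)%N.
  by rewrite -(ltr_nat R) (le_lt_trans _ c_gt) // divr_ge0 ?mulr_ge0 // ltW.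
have jt_ge2 : (2 <= j * t)%N.
  have j2 : (2 <= j)%N by rewrite /j addnC.
  have t1 : (1 <= t)%N.
    by rewrite (leq_trans _ t_ge) // muln_gt0 c_gt0 expn_gt0 /j addnS.
  by rewrite -[2%N]muln1 leq_mul.
have Q_ge : (2 ^ (j * t) <= Q)%N.
  rewrite expnM; apply: expn_le_prod => q.
  by case/mem_primes_between.
have [dQ Qd] := double_uphalf_bounds Q; rewrite -/d in dQ Qd.
have d_ge : (2 ^ (j * t).-1 <= d)%N.
  rewrite -(@leq_pmul2l 2) // -expnS prednK ?(leq_trans _ jt_ge2) //.
  exact: leq_trans Q_ge Qd.
have d_ge2 : (2 <= d)%N.
  apply: leq_trans d_ge; rewrite -[leqLHS]expn1 leq_exp2l //.
  by rewrite -ltnS prednK // (leq_trans _ jt_ge2).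
have d_gt0 : (0 < d)%N by exact: ltnW.
(* This is the constant factor in the rank bound; [n > n0] makes it at most [expR n%:R] and also
   gives [d <= n]. *)
pose n0 := ((8 * j + 7) * 2 * d)%N.
exists (d ^ n0).+1 => N N_gt M MP.
have Mtoep : toeplitz M by case: MP => // /circulant_toeplitz.
have N_gt0 : (0 < N)%N by exact: leq_ltn_trans N_gt.
have exn : exists n, (N <= d ^ n)%N by exists N; rewrite ltnW // ltn_expl.
case: (ex_minnP exn) => n N_le n_min {exn}.
have n0_lt : (n0 < n)%N.
  rewrite ltnNge; apply/negP => n_le.
  by move: N_gt; rewrite ltnNge (leq_trans N_le) // leq_exp2l.
have n_ge2 : (2 <= n)%N.
  apply: leq_ltn_trans n0_lt.
  by rewrite /n0 !muln_gt0 addn_gt0 orbT d_gt0.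
have N_gt' : (d ^ n.-1 < N)%N.
  rewrite ltnNge; apply/negP => /n_min; rewrite leqNgt => /negP[].
  by rewrite ltn_predL ltnW.
have n_gt0 : (0 < n)%N by exact: ltnW.
have n1_gt0 : (0 < n.-1)%N by rewrite -ltnS prednK // ltnW.
have d_lt_n : (d <= n)%N by rewrite (leq_trans _ (ltnW n0_lt)) // leq_pmull.
pose s : R := eps / (200 * j%:R); pose u : R := (n * t)%N%:R.
pose x : R := ln N%:R.
have s_ge0 : 0 <= s by rewrite divr_ge0 ?mulr_ge0 // ltW.
have s_le : s <= 1 / 2 by rewrite ler_pdivrMr; clear -eps_lt jr_ge c_ge0; lra.
have u_ge0 : 0 <= u by exact: ler0n.
have Nr_gt0 : 0 < N%:R :> R by rewrite ltr0n.
(* The 8 is made up of a 2 from [ln 2 >= 1 / 2] and a 4 from replacing [j * t] and [n] by their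
   predecessors. *)
have x_ge : u * j%:R / 8 <= x.
  have N_ge : (2 ^ ((j * t).-1 * n.-1) <= N)%N.
    by rewrite expnM (leq_trans _ (ltnW N_gt')) // leq_exp2r.
  have : ((j * t).-1 * n.-1)%:R * (1 / 2) <= x.
    apply: (@le_trans _ _ (((j * t).-1 * n.-1)%:R * ln 2)).
      by rewrite ler_wpM2l // half_le_ln2.
    rewrite [_ * ln 2]mulr_natl -lnXn // -natrX ler_ln ?posrE ?ltr0n ?expn_gt0 //.
    by rewrite ler_nat.
  apply: le_trans; rewrite /u -natrM.
  have : (n * t * j <= 4 * ((j * t).-1 * n.-1))%N.
    by rewrite -mulnA [(t * j)%N]mulnC mulnC leq_mul_pred.
  by rewrite -(ler_nat R) natrM; clear; lra.
(* As the exponent 0.35 is below 1/2, this makes the divisor in the target rank at most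
   [expR n%:R]. *)
have x_le : x <= n%:R * n%:R.
  have : x <= n%:R * ln d%:R.
    rewrite [_ * ln _]mulr_natl -lnXn ?ltr0n // -natrX ler_ln ?posrE ?ltr0n //.
      by rewrite ler_nat.
    by rewrite expn_gt0 d_gt0.
  move/le_trans; apply; rewrite ler_wpM2l // (le_trans (ltW (ln_sublinear _))) //.
    by rewrite ltr0n.
  by rewrite ler_nat.
have x_ge0 : 0 <= x by rewrite ln_ge0 // ler1n.
have js : 24 * j%:R * s = 12 / 100 * eps.
  by rewrite /s; field; rewrite gt_eqF.
have e_le : expR (- (2 * j%:R)) <= 6 / 100 * eps.
  rewrite expRN.
  have lb := expR_ge1Dx (2 * j%:R : R). 
  have eps_c : 300 * 400 < c%:R * eps ^+ 2 by rewrite -ltr_pdivrMr.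
  have sq_le : eps ^+ 2 <= eps by rewrite expr2 ler_piMr // ltW.
  have c_eps : c%:R * eps ^+ 2 <= c%:R * eps by rewrite ler_wpM2l.
  rewrite -[leLHS]mul1r ler_pdivrMr ?expR_gt0 //.
  apply: (@le_trans _ _ (6 / 100 * eps * c%:R)).
    by rewrite -mulrA [eps * _]mulrC; clear -eps_c c_eps; lra.
  apply: ler_wpM2l; first by clear -eps_gt0; lra.
  by clear -lb jr_ge c_ge0; lra.
have charC (p : nat) : prime p -> p%:R != 0 :> R[i].
  by move=> /prime_gt0; rewrite pnatr_eq0 lt0n.
have split := toeplitz_split_digits charC s_ge0 s_le d_gt0 dQ N_le Mtoep.
rewrite -/t -/Q -/u js in split.
have sizes : (8 * j + 7)%:R <= 9 * j%:R :> R.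
  by rewrite natrD natrM -jr_ge; clear -c_ge0; lra.
apply: (le_trans (rigidity_le (expR_ge0 _) _ split)).
  have Qn_le : (Q ^ n)%N%:R <= (2 ^ n)%:R * (d%:R * N%:R) :> R.
    rewrite -!natrM ler_nat; apply: (@leq_trans ((2 * d) ^ n)).
      by rewrite leq_exp2r.
    rewrite expnMn leq_mul2l -[X in (d ^ X <= _)%N](prednK n_gt0) expnS.
    by rewrite leq_mul2l (ltnW N_gt') !orbT.
  have us_ge : 3 * n%:R <= u * s ^+ 2.
    have t_ge' : c%:R * j%:R ^+ 2 <= t%:R :> R by rewrite -natrX -natrM ler_nat.
    have : 300 * 400 <= c%:R * eps ^+ 2 by rewrite -ler_pdivrMr // ltW.
    move=> c_eps; rewrite /u natrM -mulrA [3 * _]mulrC ler_wpM2l //.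
    rewrite /s expr_div_n mulrA ler_pdivlMr ?exprn_gt0 ?mulr_gt0 //.
    apply: (@le_trans _ _ (c%:R * eps ^+ 2 * j%:R ^+ 2)).
      rewrite (_ : 3 * _ = 300 * 400 * j%:R ^+ 2); last by ring.
      by rewrite ler_wpM2r // exprn_ge0.
    by rewrite mulrAC ler_wpM2r // ltW.
  have y_le : eps ^+ 6 * x `^ (35 / 100) <= n%:R.
    have n1 : 1 <= n%:R * n%:R :> R by rewrite -natrM ler1n muln_gt0 ltnW.
    rewrite -[leRHS]mul1r; apply: ler_pM.
    - by rewrite exprn_ge0 // ltW.
    - exact: powR_ge0.
    - by rewrite exprn_ile1 // ltW.
    apply: (@le_trans _ _ ((n%:R * n%:R) `^ (35 / 100))).
      by apply: ge0_ler_powR; rewrite ?nnegrE ?mulr_ge0 ?invr_ge0.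
    apply: (@le_trans _ _ ((n%:R * n%:R) `^ 2^-1)).
      by apply: (ler_powR n1); clear; lra.
    by rewrite powR12_sqrt ?mulr_ge0 // -expr2 sqrtr_sqr ger0_norm.
  have n0_le : (8 * j + 7)%:R * 2 * d%:R <= expR n%:R :> R.
    rewrite (le_trans _ (expR_ge1Dx _)) // -!natrM (le_trans _ (_ : n%:R <= _)) //.
      by rewrite ler_nat ltnW.
    by rewrite lerDr.
  have two_le : (2 ^ n)%:R <= expR n%:R :> R.
    rewrite natrX -[n%:R in leRHS]mulr1 expRM_natl lerXn2r ?nnegrE ?expR_ge0 //.
    by rewrite (le_trans _ (expR_ge1Dx 1)).
  rewrite ler_pdivlMr ?expR_gt0 //.
  (* The gain [expR (- (3 * n%:R))] pays for three factors of at most [expR n%:R] each: the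
     constant, the loss [2 ^ n] and the divisor in the target rank. *)
  apply: (@le_trans _ _ (((8 * j + 7)%:R * (2 * ((2 ^ n)%:R * (d%:R * N%:R) *
      expR (- (3 * n%:R))))) * expR n%:R)).
    apply: ler_pM; rewrite ?expR_ge0 ?mulr_ge0 ?expR_ge0 ?ler_expR //.
    rewrite ler_wpM2l // ler_wpM2l // ler_pM ?expR_ge0 //.
    by rewrite ler_expR lerN2.
  rewrite (_ : _ * expR n%:R = ((8 * j + 7)%:R * 2 * d%:R) * (2 ^ n)%:R *
      (expR (- (3 * n%:R)) * expR n%:R) * N%:R); last by ring.
  rewrite -expRD ler_piMl ?(ltW Nr_gt0) //.
  apply: (@le_trans _ _ (expR n%:R * expR n%:R * expR (- (3 * n%:R) + n%:R))).
    by rewrite ler_wpM2r ?expR_ge0 // ler_pM ?mulr_ge0.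
  by rewrite -!expRD -[leRHS]expR0 ler_expR; clear; lra.
rewrite /powR gt_eqF // ler_expR -/x.
(* The sparsity exponent is at most [9 * 0.18 = 1.62] times [eps * (u * j%:R)], while [x_ge] allows
   [15 / 8]. *)
apply: (@le_trans _ _ (9 * j%:R * (u * (18 / 100 * eps)))).
  apply: ler_pM => //.
    rewrite mulr_ge0 // addr_ge0 ?expR_ge0 //.
    by clear -eps_gt0; lra.
  by rewrite ler_wpM2l //; clear -e_le; lra.
apply: (@le_trans _ _ (15 * eps * (u * j%:R / 8))); last first.
  by rewrite ler_wpM2l // mulr_ge0 // ltW.
have : 0 <= eps * (u * j%:R) by rewrite !mulr_ge0 // ltW.
by clear; lra.
Qed.
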